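(* Let $G(X,Y)$ be a non-complete bipartite graph with $|X|\le |Y|$. Suppose $G(X,Y)$ is part-transitive under the action of a group $\Gamma$, and that every fragment in $X$ and every fragment in $Y$ is primitive under the action of $\Gamma$ (on $X$, resp. on $Y$). Then $\alpha(X,Y)=|Y|-d(X)+1$. Moreover: (i) if $|X|<|Y|$, then every fragment in $X$ has size $1$; (ii) if $|X|=|Y|$, then every fragment in $X$ has size $1$ or $|X|-d(X)$, unless there is a semi-imprimitive fragment in $X$ or in $Y$.
   Context: All graphs are finite and simple. A bipartite graph $G(X,Y)$ has vertex set the disjoint union of $X$ and $Y$, with every edge joining a vertex of $X$ to a vertex of $Y$; it is complete if every vertex of $X$ is adjacent to every vertex of $Y$. For a vertex $v$, $N(v)$ is its set of neighbours, and $N(A)=\bigcup_{v\in A}N(v)$ for a set $A$ of vertices. A set $A$ of vertices is independent if $A\cap N(A)=\emptyset$; it is trivial if $A\subseteq X$ or $A\subseteq Y$, and nontrivial otherwise. $\alpha(X,Y)$ denotes the maximum size of a nontrivial independent set of $G(X,Y)$. Define $\epsilon(X)=\min\{|N(A)|-|A| : \emptyset\ne A\subseteq X,\ N(A)\ne Y\}$ and $\epsilon(Y)=\min\{|N(B)|-|B| : \emptyset\ne B\subseteq Y,\ N(B)\ne X\}$. A fragment in $X$ is a nonempty $A\subseteq X$ with $N(A)\ne Y$ and $|N(A)|-|A|=\epsilon(X)$; fragments in $Y$ are defined symmetrically. $G(X,Y)$ is part-transitive under a group $\Gamma$ if $\Gamma$ acts transitively on $X$ and transitively on $Y$ and preserves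 adjacency ($x\sim y$ iff $\gamma x\sim\gamma y$); then all vertices of $X$ have a common degree $d(X)$ and all vertices of $Y$ a common degree $d(Y)$. For a group $\Gamma$ acting transitively on a finite set $Z$, a subset $B\subseteq Z$ is an imprimitive set if $1<|B|<|Z|$ and $\gamma(B)\cap B\in\{\emptyset,B\}$ for every $\gamma\in\Gamma$; a subset is primitive if it is not an imprimitive set. $B$ is semi-imprimitive if $1<|B|<|Z|$ and $|\gamma(B)\cap B|\in\{0,1,|B|\}$ for every $\gamma\in\Gamma$.
   Formalization: The graph is assumed to have at least one edge; for an edgeless graph with |X| ≥ 2 the claim fails, since the only fragments X and Y are primitive but α(X,Y)=|X|+|Y| while |Y|-d(X)+1=|Y|+1. *)

(* Defs.v *)
From HB Require Import structures.
From mathcomp Require Import all_boot all_order all_algebra.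
Set Implicit Arguments.
Unset Strict Implicit.
Unset Printing Implicit Defensive.
Import Order.TTheory GRing.Theory Num.Theory.
Local Open Scope ring_scope.

(* A graph on V is given by its adjacency relation e.  The parts of a bipartite
   graph are subsets X, Y of V, so that every notion below can be used for
   either part by exchanging X and Y.  Irreflexivity of e follows from the last
   two clauses of [bipartite]. *)
Section BipartiteGraphs.

Variables (V : finType) (e : rel V).

Definition bipartite (X Y : {set V}) : Prop :=
  [/\ symmetric e, X :|: Y = setT, [disjoint X & Y]
    & forall u v, e u v ->
        (u \in X) && (v \in Y) || (u \in Y) && (v \in X)].

Definition complete_bipartite (X Y : {set V}) : Prop :=
  {in X & Y, forall x y, e x y}.

Definition neighbours (v : V) : {set V} := [set w | e v w].

Definition nbhd (A : {set V}) : {set V} := \bigcup_(v in A) neighbours v.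

Definition independent (A : {set V}) : bool := A :&: nbhd A == set0.

Definition trivial_set (X Y A : {set V}) : bool :=
  (A \subset X) || (A \subset Y).

(* If the bipartite graph is not complete, the range is nonempty. *)
Definition alpha (X Y : {set V}) : nat :=
  \max_(A : {set V} | independent A && ~~ trivial_set X Y A) #|A|.

Definition admissible (X Y A : {set V}) : bool :=
  [&& A != set0, A \subset X & nbhd A != Y].

(* |N(A)| - |A|, which may be negative. *)
Definition excess (A : {set V}) : int := #|nbhd A|%:Z - #|A|%:Z.

(* epsilon(X) is [epsilon X Y] and epsilon(Y) is [epsilon Y X].  The default
   value #|Y| of the minimum is at least [excess A] for each admissible A, so it
   matters only if no A is admissible, that is, if the graph is complete. *)
Definition epsilon (X Y : {set V}) : int :=
  \big[Num.min/#|Y|%:Z]_(A : {set V} | admissible X Y A) excess A.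

Definition fragment (X Y A : {set V}) : bool :=
  admissible X Y A && (excess A == epsilon X Y).

(* The common degree of the vertices of X, if there is one; see
   [part_degreeP]. *)
Definition part_degree (X : {set V}) : nat :=
  \max_(x in X) #|neighbours x|.

End BipartiteGraphs.

Record group_action (Gamma : groupType) (V : Type) := GroupActionOn {
  ga_fun :> Gamma -> V -> V;
  ga_fun1 : forall v, ga_fun 1%g v = v;
  ga_funM : forall g h v, ga_fun (g * h)%g v = ga_fun g (ga_fun h v)
}.

Section Actions.

Variables (Gamma : groupType) (V : finType) (to : group_action Gamma V).

Definition transitive_on (Z : {set V}) : Prop :=
  (forall g, {in Z, forall z, to g z \in Z}) /\
  {in Z &, forall z w, exists g, to g z = w}.

Definition part_transitive (e : rel V) (X Y : {set V}) : Prop :=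
  [/\ transitive_on X, transitive_on Y
    & forall g u v, e u v = e (to g u) (to g v)].

Definition imprimitive (Z B : {set V}) : Prop :=
  [/\ B \subset Z, (1 < #|B| < #|Z|)%N
    & forall g, (to g @: B) :&: B = set0 \/ (to g @: B) :&: B = B].

Definition primitive (Z B : {set V}) : Prop :=
  B \subset Z /\ ~ imprimitive Z B.

Definition semi_imprimitive (Z B : {set V}) : Prop :=
  [/\ B \subset Z, (1 < #|B| < #|Z|)%N
    & forall g, #|(to g @: B) :&: B| \in [:: 0%N; 1%N; #|B|]].

End Actions.

Lemma part_degreeP (Gamma : groupType) (V : finType)
    (to : group_action Gamma V) (e : rel V) (X Y : {set V}) :
  part_transitive to e X Y ->
  {in X, forall x, #|neighbours e x| = part_degree e X}.
Proof.
case=> [[_ trX] _ toe] x xX.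
have toK g : cancel (to g) (to g^-1%g).
  by move=> v; rewrite -ga_funM mulVg ga_fun1.
have le_deg z w : z \in X -> w \in X ->
    (#|neighbours e z| <= #|neighbours e w|)%N.
  move=> zX wX; have [g <-] := trX z w zX wX.
  rewrite -(card_imset (mem (neighbours e z)) (can_inj (toK g))).
  apply/subset_leq_card/subsetP => _ /imsetP[v + ->].
  by rewrite !inE -toe.
apply/eqP; rewrite eqn_leq /part_degree (leq_bigmax_cond _ xX) /=.
by apply/bigmax_leqP => z zX; apply: le_deg.
Qed.

(* Main.v *)
(* For a nonempty A in X with N(A) <> Y put B = Y \ N(A).  Then N(B) misses A,
   whence epsilon(Y) = epsilon(X) + |X| - |Y|, and A |-> Y \ N(A) maps fragments
   of X to fragments of Y with |A| + |Y \ N(A)| = alpha.  By submodularity of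
   |N(.)|, if A and A' are fragments that meet and |A'| <= |Y \ N(A)|, then
   their intersection and their union are fragments as well.  Applied to A and
   its translates, this shows that a primitive fragment A with
   1 < |A| <= |Y \ N(A)| has neither minimum nor maximum size; comparing minimum
   fragments of X and of Y, one of them must be a singleton, and double counting
   of the edges decides which.  For (ii), a smallest fragment of size > 1 on
   either side meets its translates in 0, 1 or all of its points. *)
Require Import Defs.
From mathcomp Require Import all_boot all_order all_algebra.
From mathcomp Require Import zify.

Set Implicit Arguments.
Unset Strict Implicit.
Unset Printing Implicit Defensive.
Import Order.TTheory GRing.Theory Num.Theory.

(** * Neighbourhoods in a bipartite graph *)

Section Bipartite.

Variables (V : finType) (e : rel V).
Implicit Types (X Y A B : {set V}) (x y u v : V).

Lemma bipartiteC X Y : bipartite e X Y -> bipartite e Y X.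
Proof.
case=> sym_e XY dXY eXY; split=> //; first by rewrite setUC.
  by rewrite disjoint_sym.
by move=> u v /eXY; rewrite orbC.
Qed.

Lemma complete_bipartiteC X Y :
  bipartite e X Y -> complete_bipartite e X Y -> complete_bipartite e Y X.
Proof. by case=> sym_e _ _ _ cXY y x yY xX; rewrite sym_e cXY. Qed.

Lemma bipartite_notin X Y v : bipartite e X Y -> (v \in Y) = (v \notin X).
Proof.
case=> _ XY dXY _; have := in_setT v; rewrite -XY inE.
by case: (boolP (v \in X)) => //= /(disjointFr dXY)->.
Qed.

Lemma bipartite_adj X Y x y : bipartite e X Y -> x \in X -> e x y -> y \in Y.
Proof.
move=> bip xX; case: (bip) => _ _ _ eXY /eXY.
by rewrite (bipartite_notin x bip) xX /= orbF.
Qed.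

Lemma nbhdP A v : reflect (exists2 u, u \in A & e u v) (v \in nbhd e A).
Proof.
by apply: (iffP bigcupP) => -[u uA]; [rewrite inE|]; exists u; rewrite ?inE.
Qed.

Lemma nbhdU A B : nbhd e (A :|: B) = nbhd e A :|: nbhd e B.
Proof. by rewrite /nbhd bigcup_setU. Qed.

Lemma nbhd1 v : nbhd e [set v] = neighbours e v.
Proof. by rewrite /nbhd big_set1. Qed.

Lemma nbhdI_subset A B : nbhd e (A :&: B) \subset nbhd e A :&: nbhd e B.
Proof.
apply/subsetP => v /nbhdP[u /setIP[uA uB] euv].
by rewrite inE; apply/andP; split; apply/nbhdP; exists u.
Qed.

Lemma nbhd_subset X Y A : bipartite e X Y -> A \subset X -> nbhd e A \subset Y.
Proof.
move=> bip /subsetP AX; apply/subsetP => v /nbhdP[u /AX uX].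
exact: bipartite_adj bip uX.
Qed.

(** * The set of vertices missed by a neighbourhood *)

Lemma nbhd_missed X Y A :
  bipartite e X Y -> nbhd e (Y :\: nbhd e A) \subset ~: A.
Proof.
case=> sym_e _ _ _; apply/subsetP => v /nbhdP[u /setDP[_ /negP uNA] euv].
by rewrite inE; apply/negP => vA; apply/uNA/nbhdP; exists v; rewrite // sym_e.
Qed.

Lemma card_missed X Y A :
  bipartite e X Y -> A \subset X -> #|Y :\: nbhd e A| + #|nbhd e A| = #|Y|.
Proof. by move=> bip AX; rewrite cardsDS ?subnK ?subset_leq_card ?(nbhd_subset bip). Qed.

(** The new set is nonempty because [nbhd e A] is not [Y], and its own neighbourhood avoids the
    points of [A], so it is not [X]. *)
Lemma admissible_missed X Y A : bipartite e X Y -> admissible e X Y A ->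
  admissible e Y X (Y :\: nbhd e A).
Proof.
move=> bip /and3P[/set0Pn[a aA] AX NAY]; rewrite /admissible subsetDl /=.
rewrite setD_eq0; apply/andP; split.
  by apply: contra NAY => YNA; rewrite eqEsubset (nbhd_subset bip).
apply: contraTneq (subsetP AX _ aA) => <-.
by apply: contraL (aA) => /(subsetP (nbhd_missed _ bip)); rewrite inE.
Qed.

Lemma excess_missed X Y A : bipartite e X Y -> A \subset X ->
  (excess e (Y :\: nbhd e A) <= excess e A + #|X|%:Z - #|Y|%:Z)%R.
Proof.
move=> bip AX; have cY := card_missed bip AX.
have: nbhd e (Y :\: nbhd e A) \subset X :\: A.
  rewrite [X :\: A]setDE subsetI (nbhd_missed _ bip) andbT.
  exact: nbhd_subset (bipartiteC bip) (subsetDl _ _).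
move=> /subset_leq_card; rewrite cardsDS // /excess.
by have := subset_leq_card AX; lia.
Qed.

(** Keeps the default value [#|Y|] in [epsilon] from undercutting a set of least excess in
    [ex_fragment]. *)
Lemma excess_le_card X Y A :
  bipartite e X Y -> A \subset X -> (excess e A <= #|Y|%:Z)%R.
Proof.
by move=> bip AX; have := subset_leq_card (nbhd_subset bip AX); rewrite /excess; lia.
Qed.

(** * Minimum excess and the duality of fragments *)

Lemma epsilon_le X Y A : admissible e X Y A -> (epsilon e X Y <= excess e A)%R.
Proof. exact: bigmin_le_cond. Qed.

Lemma fragment_of_le X Y A : admissible e X Y A ->
  (excess e A <= epsilon e X Y)%R -> fragment e X Y A.
Proof.
by move=> admA leA; rewrite /fragment admA eq_le leA epsilon_le.
Qed.

Lemma ex_fragment X Y A : bipartite e X Y -> admissible e X Y A ->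
  exists A', fragment e X Y A'.
Proof.
move=> bip admA.
have [A' admA' minA'] := @Order.TotalTheory.arg_minP _ _ _ A
  (admissible e X Y) (excess e) admA.
exists A'; apply: fragment_of_le => //; apply/bigmin_geP; split=> //.
by apply: excess_le_card bip _; case/and3P: admA'.
Qed.

Lemma epsilon_swap_le X Y A : bipartite e X Y -> fragment e X Y A ->
  (epsilon e Y X <= epsilon e X Y + #|X|%:Z - #|Y|%:Z)%R.
Proof.
move=> bip /andP[admA /eqP <-].
apply: le_trans (epsilon_le (admissible_missed bip admA)) _.
by apply: excess_missed bip _; case/and3P: admA.
Qed.

(** The inequality of [epsilon_swap_le], read from [X] and then from [Y], bounds the difference on
    both sides. *)
Lemma epsilon_swap X Y A : bipartite e X Y -> fragment e X Y A ->
  epsilon e Y X = (epsilon e X Y + #|X|%:Z - #|Y|%:Z)%R.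
Proof.
move=> bip fA; have /andP[/(admissible_missed bip)/(ex_fragment (bipartiteC bip))] := fA.
case=> B fB _; have := epsilon_swap_le bip fA.
by have := epsilon_swap_le (bipartiteC bip) fB; lia.
Qed.

Lemma fragment_missed X Y A : bipartite e X Y -> fragment e X Y A ->
  fragment e Y X (Y :\: nbhd e A).
Proof.
move=> bip fA; have /andP[admA /eqP epsA] := fA.
apply: fragment_of_le (admissible_missed bip admA) _.
by rewrite (epsilon_swap bip fA) -epsA excess_missed //; case/and3P: admA.
Qed.

(** The right-hand side does not depend on [A]: large fragments on one side are paired with small
    ones on the other. *)
Lemma card_fragment X Y A : bipartite e X Y -> fragment e X Y A ->
  ((#|A| + #|Y :\: nbhd e A|)%N%:Z = #|Y|%:Z - epsilon e X Y)%R.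
Proof.
move=> bip /andP[/and3P[_ AX _] /eqP <-].
by have := card_missed bip AX; rewrite /excess; lia.
Qed.

Lemma fragment_gt0 X Y A : fragment e X Y A -> 0 < #|A|.
Proof. by case/andP=> /and3P[]; rewrite card_gt0. Qed.

(** A nontrivial independent [S] has its [Y]-part among the vertices missed by [S :&: X], so [#|S|]
    is at most [#|Y|] minus the excess of [S :&: X], hence at most [#|Y|] minus [epsilon e X Y]. The
    union of a fragment and the set it misses attains this bound. *)
Lemma alphaE X Y A : bipartite e X Y -> fragment e X Y A ->
  alpha e X Y = #|A| + #|Y :\: nbhd e A|.
Proof.
move=> bip fA; have /andP[/and3P[A0 AX NAY] _] := fA.
have cA := card_fragment bip fA; case: (bip) => sym_e XY dXY eXY.
have B0 := fragment_gt0 (fragment_missed bip fA).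
apply/eqP; rewrite eqn_leq; apply/andP; split.
  apply/bigmax_leqP => S /andP[/eqP indS].
  rewrite /trivial_set negb_or => /andP[/subsetPn[y yS yX] /subsetPn[x xS xY]].
  have xX : x \in X by rewrite (bipartite_notin _ (bipartiteC bip)).
  rewrite -(bipartite_notin _ bip) in yX.
  have dS : S :&: Y \subset Y :\: nbhd e (S :&: X).
    apply/subsetP => v; rewrite !inE => /andP[vS ->]; rewrite andbT.
    apply/nbhdP => -[u /setIP[uS _] euv].
    have: v \in S :&: nbhd e S by rewrite inE vS; apply/nbhdP; exists u.
    by rewrite indS inE.
  have admS : admissible e X Y (S :&: X).
    apply/and3P; split; [|exact: subsetIr|].
      by apply/set0Pn; exists x; rewrite inE xS.
    (* Nontriviality enters here: the point [y] of [S] in [Y] is missed by [S :&: X]. *)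
    apply: contraTneq (subsetP dS y _) => [->|]; first by rewrite setDv inE.
    by rewrite inE yS.
  have := epsilon_le admS; have := subset_leq_card dS.
  have := card_missed bip (subsetIr S X).
  rewrite -(cardsID X S) -(_ : S :&: Y = S :\: X) /excess; first by lia.
  by apply/setP => v; rewrite !inE (bipartite_notin _ bip) andbC.
have AB0 : A :&: (Y :\: nbhd e A) = set0.
  apply/eqP; rewrite setI_eq0; apply: disjointWr (subsetDl _ _) _.
  exact: disjointWl AX dXY.
rewrite -(subn0 (_ + _)) -(cards0 V) -AB0 -cardsU.
apply: leq_bigmax_cond; apply/andP; split.
  rewrite /independent nbhdU; apply/eqP/setP => v.
  rewrite [RHS]inE in_setI 2!in_setU; apply/negbTE/negP.
  case/andP=> vAB vN; have NAX := subsetP (nbhd_subset bip AX).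
  have NBX := subsetP (nbhd_subset (bipartiteC bip) (subsetDl Y (nbhd e A))).
  have NBA := subsetP (nbhd_missed A bip).
  case/orP: vAB => [vA | /setDP[vY vNA]]; case/orP: vN.
  - move/NAX; rewrite (bipartite_notin _ bip).
    by rewrite (subsetP AX _ vA).
  - by move/NBA; rewrite inE vA.
  - by rewrite (negbTE vNA).
  - by move/NBX; rewrite (bipartite_notin _ (bipartiteC bip)) vY.
rewrite /trivial_set negb_or.
have [a aA] := set0Pn _ A0; have [b bB] := card_gt0P B0.
apply/andP; split; apply/subsetPn.
  exists b; first by rewrite inE bB orbT.
  by rewrite -(bipartite_notin _ bip); case/setDP: bB.
exists a; first by rewrite inE aA.
by rewrite (bipartite_notin _ bip) negbK (subsetP AX).
Qed.

(* If N(A) and N(A') covered Y, then |N(A :&: A')| would be at most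
   |N(A)| + |N(A')| - |Y|, and minimality of epsilon(X) would give
   |A :&: A'| <= |A'| - |Y :\: N(A)| <= 0. *)
Lemma fragmentIU X Y A A' : bipartite e X Y ->
    fragment e X Y A -> fragment e X Y A' ->
    A :&: A' != set0 -> #|A'| <= #|Y :\: nbhd e A| ->
  fragment e X Y (A :&: A') /\ fragment e X Y (A :|: A').
Proof.
move=> bip /andP[/and3P[A0 AX NAY] /eqP epsA].
move=> /andP[/and3P[A'0 A'X NA'Y] /eqP epsA'] I0 leA'.
have NI := subset_leq_card (nbhdI_subset A A').
have NAs := nbhd_subset bip AX; have cY := card_missed bip AX.
have NU := cardsUI (nbhd e A) (nbhd e A').
have cU := cardsUI A A'.
have admI : admissible e X Y (A :&: A').
  rewrite /admissible I0 subIset ?AX //=.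
  apply: contra NAY => /eqP NIY; rewrite eqEsubset NAs -NIY.
  exact: subset_trans (nbhdI_subset _ _) (subsetIl _ _).
have epsI := epsilon_le admI.
have I_gt0 : 0 < #|A :&: A'| by rewrite card_gt0.
have admU : admissible e X Y (A :|: A').
  rewrite /admissible setU_eq0 (negbTE A0) subUset AX A'X /= nbhdU.
  by apply/eqP => NUY; rewrite NUY in NU; rewrite /excess in epsA epsA' epsI; lia.
have epsU := epsilon_le admU.
(* Submodularity: the excesses of intersection and union add up to at most twice [epsilon e X Y],
   and neither is below it, so both attain it. *)
split; apply: fragment_of_le => //.
  by rewrite /excess nbhdU in epsU epsI epsA epsA' *; lia.
by rewrite /excess nbhdU in epsU epsI epsA epsA' *; lia.
Qed.

(** * Counting edges from either part *)

Lemma edge_double_count X Y : bipartite e X Y ->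
  \sum_(x in X) #|neighbours e x| = \sum_(y in Y) #|neighbours e y|.
Proof.
move=> bip; case: (bip) => sym_e _ _ _.
have countN P Q (bipPQ : bipartite e P Q) v : v \in P ->
    #|neighbours e v| = \sum_(w in Q) e v w.
  move=> vP; rewrite -sum1_card big_mkcond [RHS]big_mkcond /=.
  apply: eq_bigr => w _; rewrite inE.
  by case: (boolP (e v w)) => [/(bipartite_adj bipPQ vP)->|]; rewrite ?if_same.
rewrite (eq_bigr _ (countN _ _ bip)) exchange_big.
rewrite (eq_bigr _ (countN _ _ (bipartiteC bip))).
by apply: eq_bigr => y _; apply: eq_bigr => x _; rewrite sym_e.
Qed.

End Bipartite.

(** * Translates of fragments under the group *)

Section Symmetric.

Variables (V : finType) (e : rel V) (Gamma : groupType).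
Variable to : group_action Gamma V.
Implicit Types (X Y A B : {set V}).

Lemma part_transitiveC X Y :
  part_transitive to e X Y -> part_transitive to e Y X.
Proof. by case. Qed.

Lemma ga_funK g : cancel (to g) (to g^-1%g).
Proof. by move=> v; rewrite -ga_funM mulVg ga_fun1. Qed.

Lemma ga_funVK g : cancel (to g^-1%g) (to g).
Proof. by move=> v; rewrite -ga_funM mulgV ga_fun1. Qed.

Lemma card_translate g A : #|to g @: A| = #|A|.
Proof. exact/card_imset/can_inj/ga_funK. Qed.

Lemma nbhd_translate X Y g A : part_transitive to e X Y ->
  nbhd e (to g @: A) = to g @: nbhd e A.
Proof.
case=> _ _ toe; apply/setP => v; apply/nbhdP/imsetP.
  case=> _ /imsetP[u uA ->] euv; exists (to g^-1%g v); rewrite ?ga_funVK //.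
  by apply/nbhdP; exists u; rewrite // (toe g) ga_funVK.
case=> w /nbhdP[u uA euw] ->; exists (to g u); first exact: imset_f.
by rewrite -toe.
Qed.

Lemma fragment_translate X Y g A : bipartite e X Y ->
  part_transitive to e X Y -> fragment e X Y A -> fragment e X Y (to g @: A).
Proof.
move=> bip pt /andP[/and3P[A0 AX NAY] /eqP epsA].
have cN : #|nbhd e (to g @: A)| = #|nbhd e A|.
  by rewrite (nbhd_translate _ _ pt) card_translate.
apply: fragment_of_le; last by rewrite -epsA /excess cN card_translate.
apply/and3P; split; first by rewrite -card_gt0 card_translate card_gt0.
  apply/subsetP => _ /imsetP[u /(subsetP AX) uX ->].
  by case: pt => -[toX _] _ _; apply: toX.
apply: contra NAY => /eqP NgA; rewrite NgA in cN.
by rewrite eqEcard (nbhd_subset bip AX) cN /=.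
Qed.

(** Transitivity on [Y] carries one edge to every vertex of [Y]. Hence [X] itself is no fragment,
    which makes fragments proper subsets. *)
Lemma nbhd_part X Y : bipartite e X Y -> part_transitive to e X Y ->
  (exists u v, e u v) -> nbhd e X = Y.
Proof.
move=> bip [[toX _] [_ trY] toe] [u [v euv]].
apply/eqP; rewrite eqEsubset (nbhd_subset bip) //=; apply/subsetP => y yY.
have [x [z [xX zY exz]]] : exists x z, [/\ x \in X, z \in Y & e x z].
  case: bip => sym_e _ _ eXY.
  by case/orP: (eXY _ _ euv) => /andP[? ?]; [exists u, v | exists v, u; rewrite sym_e].
have [g <-] := trY z y zY yY.
by apply/nbhdP; exists (to g x); rewrite ?toX // -toe.
Qed.

Lemma fragment_lt_part X Y A : bipartite e X Y -> part_transitive to e X Y ->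
  (exists u v, e u v) -> fragment e X Y A -> #|A| < #|X|.
Proof.
move=> bip pt edge /andP[/and3P[_ AX NAY] _]; apply: proper_card.
rewrite properEneq AX andbT; apply: contra NAY => /eqP->.
by rewrite (nbhd_part bip pt edge).
Qed.

Lemma fragment_translateIU X Y g A : bipartite e X Y ->
    part_transitive to e X Y -> fragment e X Y A ->
    #|A| <= #|Y :\: nbhd e A| -> (to g @: A) :&: A != set0 ->
  fragment e X Y ((to g @: A) :&: A) /\ fragment e X Y ((to g @: A) :|: A).
Proof.
move=> bip pt fA leA; rewrite setIC [_ :|: A]setUC => I0.
by apply: fragmentIU => //; [exact: fragment_translate | rewrite card_translate].
Qed.

(** * Imprimitive and semi-imprimitive fragments *)

(** If a translate meets [A], their intersection and union are fragments. Minimum size of [A] forces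
    the intersection to be [A]; maximum size forces the union to have only [#|A|] points, so both
    sets coincide. *)
Lemma imprimitive_extremal X Y A : bipartite e X Y ->
    part_transitive to e X Y -> (exists u v, e u v) -> fragment e X Y A ->
    1 < #|A| <= #|Y :\: nbhd e A| ->
    (forall A', fragment e X Y A' -> #|A| <= #|A'|) \/
    (forall A', fragment e X Y A' -> #|A'| <= #|A|) ->
  imprimitive to X A.
Proof.
move=> bip pt edge fA /andP[A1 leA] extA; split.
- by case/andP: fA => /and3P[].
- by rewrite A1 (fragment_lt_part bip pt edge fA).
move=> g; case: (eqVneq ((to g @: A) :&: A) set0) => [|I0]; first by left.
have [fI fU] := fragment_translateIU bip pt fA leA I0; right.
case: extA => [/(_ _ fI) leI | /(_ _ fU) leU].
  by apply/eqP; rewrite eqEcard subsetIr.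
apply/eqP; rewrite eqEcard subsetIr /=.
by have := cardsUI (to g @: A) A; rewrite card_translate; lia.
Qed.

(** Minimality is asked only among fragments of size above 1, so an intersection with a translate
    may also be a single point. *)
Lemma semi_imprimitive_minimal X Y A : bipartite e X Y ->
    part_transitive to e X Y -> (exists u v, e u v) -> fragment e X Y A ->
    1 < #|A| <= #|Y :\: nbhd e A| ->
    (forall A', fragment e X Y A' -> 1 < #|A'| -> #|A| <= #|A'|) ->
  semi_imprimitive to X A.
Proof.
move=> bip pt edge fA /andP[A1 leA] minA; split.
- by case/andP: fA => /and3P[].
- by rewrite A1 (fragment_lt_part bip pt edge fA).
move=> g; rewrite !inE.
case: (eqVneq ((to g @: A) :&: A) set0) => [->|I0]; first by rewrite cards0.
have [fI _] := fragment_translateIU bip pt fA leA I0.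
have := minA _ fI; have := fragment_gt0 fI.
by have := subset_leq_card (subsetIr (to g @: A) A); lia.
Qed.

(** * Single vertices and degrees *)

Lemma nbhd_vertex X Y x : part_transitive to e X Y -> x \in X ->
  #|nbhd e [set x]| = part_degree e X.
Proof. by move=> pt xX; rewrite nbhd1 (part_degreeP pt). Qed.

Lemma excess_vertex X Y x : part_transitive to e X Y -> x \in X ->
  excess e [set x] = ((part_degree e X)%:Z - 1)%R.
Proof. by move=> pt xX; rewrite /excess (nbhd_vertex pt) // cards1. Qed.

Lemma part_degree_lt X Y : bipartite e X Y -> part_transitive to e X Y ->
  ~ complete_bipartite e X Y -> part_degree e X < #|Y|.
Proof.
move=> bip pt ncomp; rewrite ltnNge; apply/negP => leY; apply: ncomp => x y xX yY.
have /eqP NY : neighbours e x == Y.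
  rewrite eqEcard (part_degreeP pt) // leY andbT -nbhd1.
  by rewrite (nbhd_subset bip) // sub1set.
by have := yY; rewrite -{1}NY inE.
Qed.

Lemma admissible_vertex X Y x : bipartite e X Y -> part_transitive to e X Y ->
  ~ complete_bipartite e X Y -> x \in X -> admissible e X Y [set x].
Proof.
move=> bip pt ncomp xX; rewrite /admissible -card_gt0 cards1 sub1set xX /=.
apply: contraTneq (part_degree_lt bip pt ncomp) => NY.
by rewrite -(nbhd_vertex pt xX) NY ltnn.
Qed.

Lemma epsilon_le_degree X Y x : bipartite e X Y -> part_transitive to e X Y ->
  ~ complete_bipartite e X Y -> x \in X ->
  (epsilon e X Y <= (part_degree e X)%:Z - 1)%R.
Proof.
move=> bip pt ncomp xX; rewrite -(excess_vertex pt xX).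
exact/epsilon_le/(admissible_vertex bip pt).
Qed.

Lemma epsilon_of_card1 X Y A : part_transitive to e X Y ->
  fragment e X Y A -> #|A| = 1 ->
  epsilon e X Y = ((part_degree e X)%:Z - 1)%R.
Proof.
move=> pt /andP[/and3P[_ AX _] /eqP <-] /eqP/cards1P[x Ax].
by rewrite Ax (excess_vertex pt) // -sub1set -Ax.
Qed.

Lemma degree_double_count X Y : bipartite e X Y -> part_transitive to e X Y ->
  #|X| * part_degree e X = #|Y| * part_degree e Y.
Proof.
move=> bip pt; have := edge_double_count bip.
rewrite (eq_bigr _ (part_degreeP pt)).
by rewrite (eq_bigr _ (part_degreeP (part_transitiveC pt))) !sum_nat_const.
Qed.

(** The smaller of the two, say [A], satisfies [#|A| <= #|B| <= #|Y :\: nbhd e A|], so it would be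
    imprimitive if it had more than one point. *)
Lemma minimum_fragments X Y A B :
    bipartite e X Y -> part_transitive to e X Y -> (exists u v, e u v) ->
    (forall A, fragment e X Y A -> primitive to X A) ->
    (forall B, fragment e Y X B -> primitive to Y B) ->
    fragment e X Y A -> fragment e Y X B ->
    (forall A', fragment e X Y A' -> #|A| <= #|A'|) ->
    (forall B', fragment e Y X B' -> #|B| <= #|B'|) ->
  #|A| = 1 \/ #|B| = 1.
Proof.
move=> bip pt edge primX primY fA fB minA minB.
have bip' := bipartiteC bip; have pt' := part_transitiveC pt.
have leAB := minB _ (fragment_missed bip fA).
have leBA := minA _ (fragment_missed bip' fB).
have A0 := fragment_gt0 fA; have B0 := fragment_gt0 fB.
case: (ltnP 1 #|A|) => [A1|?]; last by left; lia.
case: (ltnP 1 #|B|) => [B1|?]; last by right; lia.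
case: (leqP #|A| #|B|) => [leAB'|/ltnW leBA'].
  case: (primX A fA) => _ []; apply: (imprimitive_extremal bip pt edge fA); last by left.
  by rewrite A1 (leq_trans leAB').
case: (primY B fB) => _ []; apply: (imprimitive_extremal bip' pt' edge fB); last by left.
by rewrite B1 (leq_trans leBA').
Qed.

End Symmetric.

(** * The independence number and the sizes of fragments *)

Theorem theorem1p1 (V : finType) (e : rel V) (X Y : {set V})
    (Gamma : groupType) (to : group_action Gamma V)
    (bipG : bipartite e X Y)
    (ncompG : ~ complete_bipartite e X Y)
    (has_edge : exists u v, e u v)
    (leXY : (#|X| <= #|Y|)%N)
    (ptG : part_transitive to e X Y)
    (primX : forall A : {set V}, fragment e X Y A -> primitive to X A)
    (primY : forall B : {set V}, fragment e Y X B -> primitive to Y B) :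
  [/\ alpha e X Y = (#|Y| - part_degree e X + 1)%N,
      (#|X| < #|Y|)%N ->
        forall A : {set V}, fragment e X Y A -> #|A| = 1%N
    & #|X| = #|Y| ->
        ~ ((exists A : {set V},
              fragment e X Y A /\ semi_imprimitive to X A) \/
           (exists B : {set V},
              fragment e Y X B /\ semi_imprimitive to Y B)) ->
        forall A : {set V}, fragment e X Y A ->
          #|A| = 1%N \/ #|A| = (#|X| - part_degree e X)%N].
Proof.
have bip' := bipartiteC bipG; have pt' := part_transitiveC ptG.
have ncomp' : ~ complete_bipartite e Y X.
  by move/(complete_bipartiteC bip').
have [x xX] : exists x, x \in X.
  case: has_edge => u [v euv]; case: bipG => _ _ _ /(_ _ _ euv).
  by case/orP=> /andP[? ?]; [exists u | exists v].
have [y yY] : exists y, y \in Y.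
  by apply/card_gt0P; apply: leq_trans leXY; apply/card_gt0P; exists x.
have [A0 fA0] := ex_fragment bipG (admissible_vertex bipG ptG ncompG xX).
have [B0 fB0] := ex_fragment bip' (admissible_vertex bip' pt' ncomp' yY).
have eps_swap := epsilon_swap bipG fA0.
have leX := epsilon_le_degree bipG ptG ncompG xX.
have leY := epsilon_le_degree bip' pt' ncomp' yY.
have degX := part_degree_lt bipG ptG ncompG.
have degY := part_degree_lt bip' pt' ncomp'.
have count := degree_double_count bipG ptG.
have [Am fAm minA] := arg_minnP (fun A : {set V} => #|A|) fA0.
have [Bm fBm minB] := arg_minnP (fun B : {set V} => #|B|) fB0.
have eps_deg : epsilon e X Y = ((part_degree e X)%:Z - 1)%R /\
    (#|X| < #|Y| -> #|Bm| <> 1).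
  (* By [count], d(X)/|Y| and d(Y)/|X| are the same ratio r < 1, so the premise reads (1-r)|Y| <=
     (1-r)|X|. *)
  have strict : (#|Y| - part_degree e X <= #|X| - part_degree e Y) -> #|Y| <= #|X|.
    by move=> le; nia.
  have eqdeg : #|X| = #|Y| -> part_degree e X = part_degree e Y.
    by move=> eqXY; nia.
  case: (minimum_fragments bipG ptG has_edge primX primY fAm fBm minA minB).
    move=> Am1; have epsX := epsilon_of_card1 ptG fAm Am1; split=> // ltXY Bm1.
    by have := epsilon_of_card1 pt' fBm Bm1; lia.
  (* Together with [eps_swap] and [leX] this yields the premise of [strict]; hence the parts have
     equal size and, by [eqdeg], equal degrees. *)
  move=> Bm1; have := epsilon_of_card1 pt' fBm Bm1; lia.
have [epsX ncard1] := eps_deg.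
have cardF A (fA : fragment e X Y A) := card_fragment bipG fA.
split.
- by rewrite (alphaE bipG fA0); have := cardF _ fA0; lia.
- move=> ltXY A fA.
  (* As the partner of a minimum fragment in [Y], [C] is a maximum fragment in [X]; it remains to
     see that [C] is a single point. *)
  have fC := fragment_missed bip' fBm; set C := X :\: _ in fC.
  have maxC A' : fragment e X Y A' -> #|A'| <= #|C|.
    move=> fA'; have := minB _ (fragment_missed bipG fA').
    by have := cardF _ fA'; have := card_fragment bip' fBm; rewrite -/C; lia.
  have C0 := fragment_gt0 fC.
  have Bm_gt0 := fragment_gt0 fBm.
  have Bm_neq1 := ncard1 ltXY.
  (* Otherwise [Bm] would be imprimitive. The inequality in turn lets the maximum case of
     [imprimitive_extremal] apply to [C]. *)
  have ltC : #|C| < #|Bm|.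
    rewrite ltnNge; apply/negP => leBm; case: (primY _ fBm) => _ [].
    apply: (imprimitive_extremal bip' pt' has_edge fBm); last by left.
    by rewrite leBm andbT; lia.
  have A_gt0 := fragment_gt0 fA; have A_le := maxC _ fA.
  suff: ~ 1 < #|C| by lia.
  move=> C1; case: (primX _ fC) => _ [].
  apply: (imprimitive_extremal bipG ptG has_edge fC); last by right.
  by rewrite C1; have := minB _ (fragment_missed bipG fC); lia.
move=> eqXY nsemi A fA.
case: (eqVneq #|A| 1) => [|A1]; first by left.
case: (eqVneq #|A| (#|X| - part_degree e X)) => [|Ad]; first by right.
have A_gt0 := fragment_gt0 fA; have cA := cardF _ fA.
set B := Y :\: nbhd e A in cA; have fB : fragment e Y X B := fragment_missed bipG fA.
pose bigX (A' : {set V}) := fragment e X Y A' && (1 < #|A'|).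
pose bigY (B' : {set V}) := fragment e Y X B' && (1 < #|B'|).
have bigA : bigX A by rewrite /bigX fA; lia.
(* Since |A| + |B| = |X| - d(X) + 1, the excluded size of [A] is exactly the one for which [B] is a
   single point. *)
have bigB : bigY B by rewrite /bigY fB; have := fragment_gt0 fB; lia.
have [A1' /andP[fA1 A1_gt1] minA1] := arg_minnP (fun A : {set V} => #|A|) bigA.
have [B1' /andP[fB1 B1_gt1] minB1] := arg_minnP (fun B : {set V} => #|B|) bigB.
case: nsemi; case: (leqP #|A1'| #|B1'|) => [leAB|/ltnW leBA].
  left; exists A1'; split=> //.
  apply: (semi_imprimitive_minimal bipG ptG has_edge fA1) => [|A' fA' A'1].
    (* The partner of [A1'] is at least as large as [B], because [#|A1'| <= #|A|] and partner sizes
       have constant sum; so it competes with [B1']. *)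
    rewrite A1_gt1 (leq_trans leAB) // minB1 // /bigY fragment_missed //=.
    by have := cardF _ fA1; have := minA1 _ bigA; move/andP: bigB => []; lia.
  by rewrite minA1 // /bigX fA'.
right; exists B1'; split=> //.
apply: (semi_imprimitive_minimal bip' pt' has_edge fB1) => [|B' fB' B'1].
  rewrite B1_gt1 (leq_trans leBA) // minA1 // /bigX fragment_missed //=.
  by have := card_fragment bip' fB1; have := minB1 _ bigB; move/andP: bigA => []; lia.
by rewrite minB1 // /bigY fB'.
Qed.
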